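(* Let $A$ be a Fréchet-Arens-Michael algebra and let $M$, $M^{-1}$ be topologically inverse Fréchet $A$-$\hat{\otimes}$-bimodules (with respect to $i_1$, $i_2$). Then there exist an Arens-Michael algebra $\widehat{L}_A(M)$ and a topologically compatible triple of morphisms $(\theta, \alpha, \beta, \widehat{L}_A(M))$ satisfying the following universal property: for every Arens-Michael algebra $B$ and every topologically compatible triple $(\theta', \alpha', \beta', B)$ there exists a unique continuous $A$-algebra homomorphism $f : \widehat{L}_A(M) \to B$ such that $f\circ\theta = \theta'$, $f\circ\alpha = \alpha'$ and $f\circ\beta=\beta'$.
   Context: Algebras are associative unital $\mathbb{C}$-algebras. An Arens-Michael algebra is a complete locally convex algebra whose topology is defined by a family of submultiplicative seminorms; a Fréchet-Arens-Michael algebra is one whose underlying space is Fréchet. An $A$-$\hat{\otimes}$-bimodule is a complete locally convex space with an $A$-bimodule structure such that both actions are jointly continuous. $\hat{\otimes}_A$ is the completed projective tensor product over $A$. $A$-$\hat\otimes$-bimodules $M$ and $M^{-1}$ are topologically inverse if there are topological $A$-$\hat\otimes$-bimodule isomorphisms $i_1 : M \hat{\otimes}_A M^{-1} \to A$, $i_2 : M^{-1} \hat{\otimes}_A M \to A$ such that for all $x,x'\in M$, $y,y'\in M^{-1}$: $i_1(x\otimes y)x' = x\, i_2(y\otimes x')$ and $i_2(y\otimes x)y' = y\, i_1(x\otimes y')$. Let $B$ be an Arens-Michael algebra which is an $A$-algebra via a continuous homomorphism $\theta:A\to B$, and let $\alpha:M\to B$, $\beta:M^{-1}\to B$ be continuous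 $A$-$\hat\otimes$-bimodule homomorphisms. The triple $(\theta,\alpha,\beta,B)$ is topologically compatible if $\alpha(x)\beta(y)=\theta(i_1(x\otimes y))$ and $\beta(y)\alpha(x)=\theta(i_2(y\otimes x))$ for all $x\in M$, $y\in M^{-1}$ (equivalently, $m\circ(\alpha\hat\otimes\beta)=\theta\circ i_1$ and $m\circ(\beta\hat\otimes\alpha)=\theta\circ i_2$, where $m:B\hat\otimes_A B\to B$ is the multiplication). *)

(* Defs.v *)
From HB Require Import structures.
From mathcomp Require Import all_boot all_order all_algebra.
From mathcomp Require Import complex.
From mathcomp Require Import all_classical all_reals all_analysis.

Set Implicit Arguments.
Unset Strict Implicit.
Unset Printing Implicit Defensive.

Import Order.TTheory GRing.Theory Num.Theory.
Import numFieldNormedType.Exports.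

Local Open Scope classical_set_scope.
Local Open Scope ring_scope.

(* The field of complex numbers is R[i], for R : realType. *)

(* Cauchy filters are those of the additive group. The library's cauchy refers
   to the uniformity of E, and Tvs only asks that uniformity to induce the
   topology, which does not determine its Cauchy filters. *)
HB.mixin Record isCompleteHausdorff (R : realType) E & Tvs R[i] E := {
  lcs_hausdorff : hausdorff_space E;
  lcs_complete : forall F : set_system E, ProperFilter F ->
    (fun xy : E * E => xy.1 - xy.2) @ filter_prod F F --> (0 : E) ->
    exists x : E, F --> x
}.

#[short(type="completeLCSType")]
HB.structure Definition CompleteLCS (R : realType) :=
  {E of Tvs R[i] E & isCompleteHausdorff R E}.

Section seminorms.
Context (R : realType) (E : completeLCSType R).

Definition seminorm (p : E -> R) : Prop :=
  (forall x y, p (x + y) <= p x + p y) /\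
  (forall (c : R[i]) x, p (c *: x) = ComplexField.Normc.normc c * p x).

Definition defined_by_seminorms (P : set (E -> R)) : Prop :=
  (forall p, P p -> seminorm p) /\
  forall (x : E) (U : set E), nbhs x U <->
    exists F : set (E -> R), exists e : R,
      [/\ finite_set F, F `<=` P, 0 < e &
          [set y | forall p, F p -> p (y - x) < e] `<=` U].

Definition frechet : Prop :=
  exists p : nat -> E -> R, defined_by_seminorms (range p).

End seminorms.

Section bilinear.
Context (R : realType) (U V W : completeLCSType R).

Definition continuous_bilinear (phi : U -> V -> W) : Prop :=
  [/\ forall v, linear (phi ^~ v), forall u, linear (phi u) &
      continuous (fun uv : U * V => phi uv.1 uv.2)].

End bilinear.

(* The library's algType excludes the zero algebra, which must be allowed here:
   the universal algebra may vanish even when A does not. Its zero-allowing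
   pzRingType cannot be joined with lmodType outside algType, hence the
   operations below. Joint continuity of the product follows from
   am_seminorms. *)
HB.mixin Record isArensMichael (R : realType) A & CompleteLCS R A := {
  am_one : A;
  am_mul : A -> A -> A;
  am_mulA : associative am_mul;
  am_mul1l : left_id am_one am_mul;
  am_mul1r : right_id am_one am_mul;
  am_linearl : forall y, linear (am_mul ^~ y);
  am_linearr : forall x, linear (am_mul x);
  am_seminorms : exists2 P : set (A -> R), defined_by_seminorms P &
    forall p, P p -> forall x y, p (am_mul x y) <= p x * p y
}.

#[short(type="arensMichaelType")]
HB.structure Definition ArensMichael (R : realType) :=
  {A of CompleteLCS R A & isArensMichael R A}.

HB.mixin Record isBimodule (R : realType) (A : arensMichaelType R) M
    & CompleteLCS R M := {
  lact : A -> M -> M;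
  ract : M -> A -> M;
  lact_bilinear : continuous_bilinear lact;
  ract_bilinear : continuous_bilinear ract;
  lact1 : forall x, lact am_one x = x;
  ract1 : forall x, ract x am_one = x;
  lactM : forall a b x, lact (am_mul a b) x = lact a (lact b x);
  ractM : forall x a b, ract x (am_mul a b) = ract (ract x a) b;
  lract : forall a x b, ract (lact a x) b = lact a (ract x b)
}.

#[short(type="bimodType")]
HB.structure Definition Bimodule (R : realType) (A : arensMichaelType R) :=
  {M of CompleteLCS R M & isBimodule R A M}.

Section tensor.
Context (R : realType) (A : arensMichaelType R) (M N : bimodType A).

Definition balanced (W : completeLCSType R) (phi : M -> N -> W) : Prop :=
  forall x a y, phi (ract x a) y = phi x (lact a y).

(* T, with x ⊗ y := tau x y, is the completed projective tensor product of M
   and N over A, carrying the A-bimodule structure induced by those of M and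
   N. *)
Definition is_tensor (T : bimodType A) (tau : M -> N -> T) : Prop :=
  [/\ continuous_bilinear tau,
      balanced tau,
      forall (W : completeLCSType R) (phi : M -> N -> W),
        continuous_bilinear phi -> balanced phi ->
        exists! psi : T -> W,
          [/\ linear psi, continuous psi &
              forall x y, psi (tau x y) = phi x y],
      forall a x y, lact a (tau x y) = tau (lact a x) y &
      forall x y a, ract (tau x y) a = tau x (ract y a)].

End tensor.

Section morphisms.
Context (R : realType).

Definition alg_hom (A B : arensMichaelType R) (f : A -> B) : Prop :=
  [/\ linear f, continuous f, f am_one = am_one &
      {morph f : x y / am_mul x y}].

(* B is seen as an A-bimodule via theta. *)
Definition bimod_hom (A B : arensMichaelType R) (theta : A -> B)
    (M : bimodType A) (f : M -> B) : Prop :=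
  [/\ linear f, continuous f,
      forall a x, f (lact a x) = am_mul (theta a) (f x) &
      forall x a, f (ract x a) = am_mul (f x) (theta a)].

Definition bimod_iso (A : arensMichaelType R) (T : bimodType A)
    (i : T -> A) : Prop :=
  bimod_hom idfun i /\
  exists j : A -> T, [/\ cancel i j, cancel j i & continuous j].

Definition topologically_inverse (A : arensMichaelType R)
    (M Minv T1 T2 : bimodType A)
    (tau1 : M -> Minv -> T1) (tau2 : Minv -> M -> T2)
    (i1 : T1 -> A) (i2 : T2 -> A) : Prop :=
  [/\ bimod_iso i1,
      bimod_iso i2,
      forall x y x', lact (i1 (tau1 x y)) x' = ract x (i2 (tau2 y x')) &
      forall y x y', lact (i2 (tau2 y x)) y' = ract y (i1 (tau1 x y'))].

Definition topologically_compatible (A : arensMichaelType R)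
    (M Minv T1 T2 : bimodType A)
    (tau1 : M -> Minv -> T1) (tau2 : Minv -> M -> T2)
    (i1 : T1 -> A) (i2 : T2 -> A)
    (B : arensMichaelType R)
    (theta : A -> B) (alpha : M -> B) (beta : Minv -> B) : Prop :=
  [/\ alg_hom theta,
      bimod_hom theta alpha,
      bimod_hom theta beta,
      forall x y, am_mul (alpha x) (beta y) = theta (i1 (tau1 x y)) &
      forall x y, am_mul (beta y) (alpha x) = theta (i2 (tau2 y x))].

End morphisms.

(* Main.v *)
Require Import Defs.
From HB Require Import structures.
From mathcomp Require Import all_boot all_order all_algebra.
From mathcomp Require Import complex.
From mathcomp Require Import all_classical all_reals all_analysis.
From mathcomp Require Import lra.

(* Call a pair (B, g), with B an Arens-Michael algebra and g a map from the set
   X = A + M + Minv to B, admissible if the three components of g form a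
   topologically compatible triple. The universal algebra consists of the
   filters of formal algebra expressions over X whose values converge in B for
   every admissible (B, g), two filters being identified when all these limits
   agree. The limit maps are jointly injective and their topology is declared
   initial, so every algebraic identity, seminorm estimate and compatibility
   relation is inherited from the algebras B; the limit map itself is the
   morphism to B, unique because expressions are dense. Filters of
   expressions form a set, whereas the product of all B would be too large. *)

Set Implicit Arguments.
Unset Strict Implicit.
Unset Printing Implicit Defensive.

Import Order.TTheory GRing.Theory Num.Theory.
Import numFieldNormedType.Exports.
Import ComplexField.Normc.

Local Open Scope classical_set_scope.
Local Open Scope ring_scope.
Local Open Scope quotient_scope.

(** The norm of [R[i]] is itself valued in [R[i]], while seminorms are real-valued; this passes
    between the two. *)
Lemma norm_normc (R : realType) (c : R[i]) : `|c| = (normc c)%:C%C.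
Proof. by rewrite normc_def; case: c. Qed.

(** * Seminorms on a complex vector space and their neighbourhoods *)

Section seminorm_nbhs.
Context (R : realType) (V : lmodType R[i]).
Implicit Types (p : V -> R) (P : set (V -> R)).

(* seminorm and defined_by_seminorms ask for a complete space; is_seminorm and
   seminorm_nbhs are their counterparts before any topology is available. *)
Definition is_seminorm p : Prop :=
  (forall x y, p (x + y) <= p x + p y) /\
  (forall (c : R[i]) x, p (c *: x) = normc c * p x).

Lemma is_seminorm0 p : is_seminorm p -> p 0 = 0.
Proof. by case=> _ /(_ 0 0); rewrite scaler0 normc0 mul0r. Qed.

Lemma is_seminormN p x : is_seminorm p -> p (- x) = p x.
Proof.
case=> _ pZ; rewrite -scaleN1r pZ.
suff -> : normc (- 1 : R[i]) = 1 by rewrite mul1r.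
by have /eqP := norm_normc (- 1 : R[i]); rewrite normrN1 eq_complex /=
  => /andP[/eqP <-].
Qed.

Lemma is_seminorm_ge0 p x : is_seminorm p -> 0 <= p x.
Proof.
move=> ps; have := ps.1 x (- x).
by rewrite subrr is_seminorm0// is_seminormN// -mulr2n pmulrn_lge0.
Qed.

Lemma filter_forall_finite (I : choiceType) (T : Type) (G : set_system T)
    (F : set I) (Q : I -> T -> Prop) : Filter G -> finite_set F ->
  (forall i, F i -> G (Q i)) -> G [set y | forall i, F i -> Q i y].
Proof.
move=> FG /finite_fsetP[H ->] GQ.
apply: filterS (@filter_bigI _ _ H Q G _ _) => [y Hy i|i]; first exact: Hy.
exact: GQ.
Qed.

Definition seminorm_nbhs P (x : V) (U : set V) : Prop :=
  exists F : set (V -> R), exists e : R,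
    [/\ finite_set F, F `<=` P, 0 < e &
        [set y | forall p, F p -> p (y - x) < e] `<=` U].

Lemma seminorm_nbhs_ball P p x e : P p -> 0 < e ->
  seminorm_nbhs P x [set y | p (y - x) < e].
Proof.
move=> Pp e0; exists [set p], e; split => //.
- by move=> _ ->.
- by move=> y /(_ p); exact.
Qed.

(** Basic neighbourhoods are finite intersections of balls of single seminorms, so those balls
    suffice to test convergence. *)
Lemma filter_seminorm_nbhs P x (F : set_system V) : Filter F ->
  (forall p e, P p -> 0 < e -> F [set y | p (y - x) < e]) ->
  seminorm_nbhs P x `<=` F.
Proof.
move=> FF Fball U [G [e [Gfin GP e0 GU]]]; apply: filterS GU _.
by apply: filter_forall_finite => // p /GP Pp; exact: Fball.
Qed.

End seminorm_nbhs.

(** * The locally convex topology of a family of seminorms *)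

Section seminorm_topology.
Local Open Scope convex_scope.
Context (R : realType) (V : lmodType R[i]) (P : set (V -> R)).
Hypothesis Psn : forall p, P p -> is_seminorm p.

(** The phantom argument makes this copy of [V] remember [P], so that the topology of [P] can be
    attached to it as an instance. *)
Definition seminormed of (forall p, P p -> is_seminorm p) : Type := V.

Local Notation E := (seminormed Psn).

HB.instance Definition _ := GRing.Lmodule.on E.

HB.instance Definition _ := hasNbhs.Build E (seminorm_nbhs P).

Let nbhs_filter (x : E) : ProperFilter (nbhs x).
Proof.
have x0 p : P p -> p (x - x) = 0.
  by move=> Pp; rewrite subrr is_seminorm0//; exact: Psn.
split.
- move=> [F [e [_ FP e0 /(_ x)]]]; apply => p Fp /=.
  by rewrite x0//; exact: FP.
- split.
  + by exists set0, 1; split => //; exact: finite_set0.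
  + move=> A B [F [e [Ffin FP e0 FA]]] [G [d [Gfin GP d0 GB]]].
    exists (F `|` G), (Num.min e d); split.
    * by rewrite finite_setU.
    * by rewrite subUset.
    * by rewrite lt_min e0 d0.
    * move=> y H; split.
        apply: FA => p Fp.
        by have := H p (or_introl Fp); rewrite lt_min => /andP[].
      apply: GB => p Gp.
      by have := H p (or_intror Gp); rewrite lt_min => /andP[].
  + move=> A B AB [F [e [Ffin FP e0 FA]]].
    by exists F, e; split => //; exact: subset_trans AB.
Qed.

Let nbhs_singleton (x : E) (A : set E) : nbhs x A -> A x.
Proof.
move=> [F [e [_ FP e0]]]; apply => p Fp /=.
by rewrite subrr is_seminorm0//; apply: Psn; exact: FP.
Qed.

(** Balls are open: by the triangle inequality, radius [e - p (y - x)] around [y] stays inside, for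
    each of the finitely many [p]. *)
Let ball_nbhs (F : set (V -> R)) (e : R) (x : E) : finite_set F -> F `<=` P ->
  forall y : E, (forall p, F p -> p (y - x) < e) ->
  seminorm_nbhs P y [set z | forall p, F p -> p (z - x) < e].
Proof.
move=> Ffin FP y xy.
have ? := nbhs_filter (y : E).
apply: (@filter_forall_finite _ _ (nbhs y)) => // p Fp.
have sp := Psn (FP _ Fp).
have /filterS : seminorm_nbhs P y [set z | p (z - y) < e - p (y - x)].
  by apply: seminorm_nbhs_ball; [exact: FP|rewrite subr_gt0; exact: xy].
apply => z /=; rewrite ltrBrDr; apply: le_lt_trans.
by rewrite -(subrKA y); exact: sp.1.
Qed.

Let nbhs_nbhs (x : E) (A : set E) : nbhs x A -> nbhs x (nbhs^~ A).
Proof.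
move=> [F [e [Ffin FP e0 FA]]]; exists F, e; split => // y xy.
have ? := nbhs_filter (y : E).
by have /(filterS FA) : nbhs (y : E) _ := ball_nbhs Ffin FP xy.
Qed.

HB.instance Definition _ :=
  Nbhs_isNbhsTopological.Build E nbhs_filter nbhs_singleton nbhs_nbhs.

Let add_continuous : continuous (fun x : E * E => x.1 + x.2).
Proof.
move=> [x y]; apply: filter_seminorm_nbhs => p e Pp e0.
have e20 : 0 < e / 2 by rewrite divr_gt0.
exists ([set z | p (z - x) < e / 2], [set z | p (z - y) < e / 2]).
  by split; exact: seminorm_nbhs_ball.
move=> [z t] /= [zx ty]; rewrite opprD addrACA [e]splitr.
by apply: le_lt_trans ((Psn Pp).1 _ _) _; rewrite ltrD.
Qed.

Let scale_continuous : continuous (fun z : R[i]^o * E => z.1 *: z.2).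
Proof.
move=> [c x]; apply: filter_seminorm_nbhs => p e Pp e0.
have [pD pZ] := Psn Pp.
have p0 y : 0 <= p y by apply: is_seminorm_ge0; exact: Psn.
have c0 (d : R[i]) : 0 <= normc d by case: d => a b; exact: sqrtr_ge0.
(* The three terms of the splitting of [b *: y - c *: x] below sum to less than
   [d * (d + p x + normc c)], which is at most [d * k] since [d <= 1], hence at most [e]. *)
pose k := 1 + normc c + p x.
have k0 : 0 < k by rewrite /k; have := c0 c; have := p0 x; lra.
pose d := Num.min 1 (e / k).
have d0 : 0 < d by rewrite lt_min ltr01 divr_gt0.
exists ([set b | normc (b - c) < d], [set y | p (y - x) < d]).
  split; last exact: seminorm_nbhs_ball.
  apply/nbhs_ballP; exists d%:C%C => /=; first by rewrite ltcR.
  by move=> b /=; rewrite -ball_normE /= distrC norm_normc ltcR.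
move=> [b y] /= [bc yx].
have -> : b *: y - c *: x = (b - c) *: (y - x) + ((b - c) *: x + c *: (y - x)).
  by rewrite addrA -scalerDr subrK scalerBl scalerBr addrA subrK.
apply: le_lt_trans (pD _ _) _.
apply: (@le_lt_trans _ _ (normc (b - c) * p (y - x) +
    (normc (b - c) * p x + normc c * p (y - x)))).
  by rewrite -!pZ lerD2l; exact: pD.
have d1 : d <= 1 by rewrite ge_min lexx.
have dk : d * k <= e by rewrite -ler_pdivlMr// ge_min lexx orbT.
move: (c0 (b - c)) (c0 c) (p0 x) (p0 (y - x)) => *.
rewrite /k in dk; nra.
Qed.

Let locally_convex :
  exists2 B : set_system E, (forall b, b \in B -> convex_set b) & basis B.
Proof.
exists [set B | exists F : set (V -> R), exists e : R, exists x : E,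
  [/\ finite_set F, F `<=` P & B = [set y | forall p, F p -> p (y - x) < e]]].
  move=> _ /[!inE] -[F [e [x [_ FP ->]]]].
  apply/convex_setW => y z /set_mem yx /set_mem zx l l0 l1.
  apply/mem_set => p Fp.
  have [pD pZ] := Psn (FP _ Fp).
  have conv :
      y <| l |> z - x = l%:num *: (y - x) + (1 - l%:num) *: (z - x) :> V.
    rewrite !scalerBr addrACA -opprD -scalerDl [l%:num + _]addrC subrK scale1r.
    by [].
  (* The weights are nonnegative elements of [R[i]], so their moduli also add up to 1 and [e] splits
     in the same proportion. *)
  have nl : normc l%:num + normc (1 - l%:num) = 1 :> R.
    apply: complexI; rewrite rmorphD /= -!norm_normc.
    rewrite !ger0_norm ?subr_ge0 ?ltW//.
    by rewrite addrC subrK rmorph1.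
  rewrite conv; apply: le_lt_trans (pD _ _) _; rewrite !pZ.
  rewrite -[e]mul1r -nl mulrDl ltr_leD//.
    by rewrite ltr_pM2l ?yx// -ltcR -norm_normc gtr0_norm.
  by rewrite ler_wpM2l ?(ltW (zx _ Fp))// -lecR -norm_normc normr_ge0.
split.
  move=> _ [F [e [x [Ffin FP ->]]]]; rewrite openE => y; exact: ball_nbhs.
move=> x U [F [e [Ffin FP e0 FU]]].
exists [set y | forall p, F p -> p (y - x) < e] => //; split.
  by exists F, e, x.
by move=> p Fp; rewrite subrr is_seminorm0//; apply: Psn; exact: FP.
Qed.

(* This factory only builds the uniformity: it does not register its own fields
   as instances. *)
HB.instance Definition _ := PreTopologicalLmod_isTvs.Build R[i] E
  add_continuous scale_continuous locally_convex.
HB.instance Definition _ :=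
  PreTopologicalNmodule_isTopologicalNmodule.Build E add_continuous.
HB.instance Definition _ :=
  TopologicalNmodule_isTopologicalLmodule.Build R[i] E scale_continuous.
HB.instance Definition _ := Uniform_isTvs.Build R[i] E locally_convex.

End seminorm_topology.

(** * Convergence in complete locally convex spaces and Arens-Michael algebras *)

Section lcs.
Context (R : realType) (E : completeLCSType R) (P : set (E -> R)).
Hypothesis EP : defined_by_seminorms P.

Lemma lcs_cvgP (F : set_system E) (x : E) : Filter F ->
  F --> x <-> forall p e, P p -> 0 < e -> F [set y | p (y - x) < e].
Proof.
move=> FF; have nE U := EP.2 x U; split => [Fx p e Pp e0|Fball U /nE].
  by apply: Fx; apply/nE; exact: seminorm_nbhs_ball.
exact: filter_seminorm_nbhs.
Qed.

End lcs.

Section lcs_cvg.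
Context (R : realType) (E : completeLCSType R).

Lemma lcs_cvg_unique (F : set_system E) (x y : E) : ProperFilter F ->
  F --> x -> F --> y -> x = y.
Proof. by move=> FF; apply: cvg_unique; exact: lcs_hausdorff. Qed.

Lemma lcs_scale_continuous (c : R[i]) : continuous (fun x : E => c *: x).
Proof.
move=> x; apply: (continuous_comp (f := fun x : E => (c : R[i]^o, x))
  (g := fun z : R[i]^o * E => z.1 *: z.2)); last exact: scale_continuous.
apply: (@cvg_pair _ _ _ _ (nbhs (c : R[i]^o))); first exact: cvg_cst.
exact: cvg_id.
Qed.

End lcs_cvg.

Section arens_michael.
Context (R : realType) (B : arensMichaelType R).

(** Submultiplicativity bounds each term of [xy - ab = (x - a)(y - b) + (x - a)b + a(y - b)]; the
    constants [k] and [d] are the analogues of those for scalar multiplication. *)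
Lemma am_mul_continuous : continuous (fun xy : B * B => am_mul xy.1 xy.2).
Proof.
move=> [a b]; have [P BP Pm] := @am_seminorms R B.
apply/(lcs_cvgP BP) => p e Pp e0.
have sp : is_seminorm p := BP.1 _ Pp.
have p0 x : 0 <= p x := is_seminorm_ge0 x sp.
pose k := 1 + p a + p b.
have k0 : 0 < k by rewrite /k; have := p0 a; have := p0 b; lra.
pose d := Num.min 1 (e / k).
have d0 : 0 < d by rewrite lt_min ltr01 divr_gt0.
exists ([set x | p (x - a) < d], [set y | p (y - b) < d]).
  by split; apply/(BP.2 _ _); exact: seminorm_nbhs_ball.
move=> [x y] /= [xa yb].
have -> : am_mul x y - am_mul a b =
    am_mul (x - a) (y - b) + (am_mul (x - a) b + am_mul a (y - b)).
  have ml u v w : am_mul (u - v) w = am_mul u w - am_mul v w :> B.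
    by have := am_linearl w (-1) v u; rewrite !scaleN1r ![- _ + _]addrC.
  have mr u v w : am_mul w (u - v) = am_mul w u - am_mul w v :> B.
    by have := am_linearr w (-1) v u; rewrite !scaleN1r ![- _ + _]addrC.
  by rewrite addrA [am_mul _ (_ - _)]mr subrK ml mr addrA subrK.
apply: le_lt_trans (sp.1 _ _) _.
apply: (@le_lt_trans _ _ (p (x - a) * p (y - b) +
    (p (x - a) * p b + p a * p (y - b)))).
  by rewrite lerD ?Pm// (le_trans (sp.1 _ _))// lerD ?Pm.
have d1 : d <= 1 by rewrite ge_min lexx.
have dk : d * k <= e by rewrite -ler_pdivlMr// ge_min lexx orbT.
move: (p0 a) (p0 b) (p0 (x - a)) (p0 (y - b)) => *.
rewrite /k in dk; nra.
Qed.

End arens_michael.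

(** * Formal algebra expressions and their values *)

Section expressions.
Context (R : realType) (X : Type).

(** Bare terms with no algebra laws imposed; the laws come from evaluation. Zero and opposites are
    obtained by scaling with 0 and -1. *)
Inductive expr : Type :=
| EGen of X
| EOne
| EAdd of expr & expr
| EMul of expr & expr
| EScale of R[i] & expr.

Context (B : arensMichaelType R).

Fixpoint eval (g : X -> B) (t : expr) : B :=
  match t with
  | EGen x => g x
  | EOne => am_one
  | EAdd t u => eval g t + eval g u
  | EMul t u => am_mul (eval g t) (eval g u)
  | EScale c t => c *: eval g t
  end.

End expressions.
Arguments EOne {R X}.

Lemma linearDZ (K : pzRingType) (U V : lmodType K) (f : U -> V) : linear f ->
  (forall x y, f (x + y) = f x + f y) * (forall c x, f (c *: x) = c *: f x).
Proof.
move=> lf; have fD x y : f (x + y) = f x + f y.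
  by have := lf 1 x y; rewrite !scale1r.
split=> // c x; have f0 : f 0 = 0.
  by apply: (addrI (f 0)); rewrite -fD !addr0.
by have := lf c x 0; rewrite !addr0 f0 addr0.
Qed.

Lemma alg_hom_eval (R : realType) (X : Type) (A B : arensMichaelType R)
    (f : A -> B) (g : X -> A) (t : expr R X) : alg_hom f ->
  f (eval g t) = eval (f \o g) t.
Proof.
case=> /linearDZ[fD fZ] _ f1 fM; elim: t => //= [t <- u <-|t <- u <-|c t <-].
- exact: fD.
- exact: fM.
- exact: fZ.
Qed.

(** * The universal algebra of an arbitrary class [K] of maps on generators *)

Section universal.
Context (R : realType) (X : Type).
Variable K : forall B : arensMichaelType R, (X -> B) -> Prop.

(** All algebras [B] are quantified over only inside a proposition, so this type is no larger than
    that of filters on expressions, and its quotient can itself be one of the algebras [B]. *)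
Record conv_filter := ConvFilter {
  cf_sets :> set_system (expr R X);
  cf_proper : ProperFilter cf_sets;
  cf_cvg : forall (B : arensMichaelType R) (g : X -> B), K g ->
    exists b : B, eval g @ cf_sets --> b
}.

HB.instance Definition _ := gen_eqMixin conv_filter.
HB.instance Definition _ := gen_choiceMixin conv_filter.
#[local] Existing Instance cf_proper.

(** The default 0 is never reached when [K g] holds. *)
Definition cf_lim (B : arensMichaelType R) (g : X -> B) (F : conv_filter) : B :=
  xget 0 [set b : B | eval g @ cf_sets F --> b].

Lemma cf_limP (B : arensMichaelType R) (g : X -> B) (F : conv_filter) :
  K g -> eval g @ cf_sets F --> cf_lim g F.
Proof. by move=> /(cf_cvg F); exact: xgetPex. Qed.

Definition cf_equiv (F G : conv_filter) : bool :=
  `[< forall (B : arensMichaelType R) (g : X -> B), K g ->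
      cf_lim g F = cf_lim g G >].

Lemma cf_equiv_refl : reflexive cf_equiv.
Proof. by move=> F; apply/asboolP. Qed.

Lemma cf_equiv_sym : symmetric cf_equiv.
Proof.
by move=> F G; apply/asboolP/asboolP => FG B g Kg; rewrite FG.
Qed.

Lemma cf_equiv_trans : transitive cf_equiv.
Proof.
move=> G F H /asboolP FG /asboolP GH; apply/asboolP => B g Kg.
by rewrite FG ?GH.
Qed.

Canonical cf_equiv_rel :=
  EquivRel cf_equiv cf_equiv_refl cf_equiv_sym cf_equiv_trans.

Definition univ : Type := {eq_quot cf_equiv}.
HB.instance Definition _ := Choice.on univ.
HB.instance Definition _ := EqQuotient.on univ.

(** The limit map to [B]; when [K g] holds, the value does not depend on the representative. *)
Definition ev (B : arensMichaelType R) (g : X -> B) (x : univ) : B :=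
  cf_lim g (repr x).

Lemma ev_inj (x y : univ) :
  (forall (B : arensMichaelType R) (g : X -> B), K g -> ev g x = ev g y) ->
  x = y.
Proof.
by move=> xy; rewrite -[x]reprK -[y]reprK; apply/eqmodP/asboolP.
Qed.

(** The source of all points constructed below. It returns a witness rather than a bare existence,
    so that operations can be defined from it. *)
Lemma univ_ex (F : set_system (expr R X))
    (phi : forall B : arensMichaelType R, (X -> B) -> B) : ProperFilter F ->
  (forall (B : arensMichaelType R) (g : X -> B), K g ->
    eval g @ F --> phi B g) ->
  {x : univ | forall (B : arensMichaelType R) (g : X -> B), K g ->
    ev g x = phi B g}.
Proof.
move=> FF Fphi; apply: cid.
have Fcvg (B : arensMichaelType R) (g : X -> B) : K g ->
    exists b : B, eval g @ F --> b.
  by move=> /Fphi; exists (phi B g).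
exists (\pi_univ (ConvFilter FF Fcvg)) => B g Kg; rewrite /ev.
(* The chosen representative [G] may differ from the given filter, but has the same limits. *)
case: piP => G /eqmodP/asboolP/(_ B g Kg) <-.
have FG : ProperFilter (eval g @ F) by exact: fmap_proper_filter.
apply: (lcs_cvg_unique FG _ (Fphi B g Kg)).
exact: (cf_limP (F := ConvFilter FF Fcvg) Kg).
Qed.

Lemma expr_ex (t : expr R X) :
  {x : univ | forall (B : arensMichaelType R) (g : X -> B), K g ->
    ev g x = eval g t}.
Proof.
(* The principal filter at [t] has the constant limit [eval g t]. *)
apply: (univ_ex (globally_properfilter (erefl : [set t] t))).
by move=> B g _ U /nbhs_singleton Ut _ ->.
Qed.

(** The image under the syntactic operation of a filter representing [x] still converges, because
    the operation is continuous in every [B]. *)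
Lemma op1_ex (op : expr R X -> expr R X)
    (opB : forall B : arensMichaelType R, B -> B) (x : univ) :
  (forall (B : arensMichaelType R) (g : X -> B) t,
    eval g (op t) = opB B (eval g t)) ->
  (forall B : arensMichaelType R, continuous (opB B)) ->
  {y : univ | forall (B : arensMichaelType R) (g : X -> B), K g ->
    ev g y = opB B (ev g x)}.
Proof.
move=> opE opc.
apply: (univ_ex (F := op @ cf_sets (repr x))
  (phi := fun B g => opB B (ev g x))).
move=> B g Kg U /(opc B (ev g x))/(cf_limP (F := repr x) Kg).
by apply: (filterS (F := cf_sets (repr x))) => t /=; rewrite opE.
Qed.

(** As in the unary case, with the product of the two representing filters; this is where joint
    continuity enters. *)
Lemma op2_ex (op : expr R X -> expr R X -> expr R X)
    (opB : forall B : arensMichaelType R, B -> B -> B) (x y : univ) :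
  (forall (B : arensMichaelType R) (g : X -> B) t u,
    eval g (op t u) = opB B (eval g t) (eval g u)) ->
  (forall B : arensMichaelType R,
    continuous (fun ab : B * B => opB B ab.1 ab.2)) ->
  {z : univ | forall (B : arensMichaelType R) (g : X -> B), K g ->
    ev g z = opB B (ev g x) (ev g y)}.
Proof.
move=> opE opc.
apply: (univ_ex (F := (fun tu => op tu.1 tu.2) @
    filter_prod (cf_sets (repr x)) (cf_sets (repr y)))
  (phi := fun B g => opB B (ev g x) (ev g y))).
move=> B g Kg U /(opc B (ev g x, ev g y)) [[V W] /= [Vx Wy] VW].
exists (eval g @^-1` V, eval g @^-1` W) => /=.
  split; first exact: (cf_limP (F := repr x) Kg).
  exact: (cf_limP (F := repr y) Kg).
by move=> [t u] /= [Vt Wu]; rewrite opE; exact: (VW (_, _)).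
Qed.

Definition univ_of_expr t := sval (expr_ex t).
Definition univ_zero := univ_of_expr (EScale 0 EOne).
Definition univ_one := univ_of_expr EOne.

Definition univ_scale c x :=
  sval (@op1_ex (EScale c) (fun B b => c *: b) x (fun _ _ _ => erefl)
    (fun B => @lcs_scale_continuous R B c)).

Definition univ_add x y :=
  sval (@op2_ex (@EAdd R X) (fun B a b => a + b) x y
    (fun _ _ _ _ => erefl) (fun B => @add_continuous B)).
Definition univ_mul x y :=
  sval (@op2_ex (@EMul R X) (fun B a b => am_mul a b) x y
    (fun _ _ _ _ => erefl) (fun B => @am_mul_continuous R B)).

Section ev_theory.
Context (B : arensMichaelType R) (g : X -> B) (Kg : K g).

Lemma ev_expr t : ev g (univ_of_expr t) = eval g t.
Proof. exact: (svalP (expr_ex t)). Qed.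

Lemma ev_scale c x : ev g (univ_scale c x) = c *: ev g x.
Proof. by rewrite /univ_scale; case: op1_ex => y /= ->. Qed.

Lemma ev_add x y : ev g (univ_add x y) = ev g x + ev g y.
Proof. by rewrite /univ_add; case: op2_ex => z /= ->. Qed.

Lemma ev_mul x y : ev g (univ_mul x y) = am_mul (ev g x) (ev g y).
Proof. by rewrite /univ_mul; case: op2_ex => z /= ->. Qed.

Lemma ev_zero : ev g univ_zero = 0.
Proof. by rewrite ev_expr /= scale0r. Qed.

Lemma ev_one : ev g univ_one = am_one.
Proof. by rewrite ev_expr. Qed.

Definition evE := (ev_scale, ev_add, ev_mul, ev_zero, ev_one).

End ev_theory.

(** * Vector space structure of the universal algebra *)

Let univ_addA : associative univ_add.
Proof. by move=> x y z; apply: ev_inj => B g Kg; rewrite !evE// addrA. Qed.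

Let univ_addC : commutative univ_add.
Proof. by move=> x y; apply: ev_inj => B g Kg; rewrite !evE// addrC. Qed.

Let univ_add0 : left_id univ_zero univ_add.
Proof. by move=> x; apply: ev_inj => B g Kg; rewrite !evE// add0r. Qed.

Let univ_addN : left_inverse univ_zero (univ_scale (-1)) univ_add.
Proof.
by move=> x; apply: ev_inj => B g Kg; rewrite !evE// scaleN1r addNr.
Qed.

HB.instance Definition _ :=
  GRing.isZmodule.Build univ univ_addA univ_addC univ_add0 univ_addN.

Let univ_scaleA a b x : univ_scale a (univ_scale b x) = univ_scale (a * b) x.
Proof. by apply: ev_inj => B g Kg; rewrite !evE// scalerA. Qed.

Let univ_scale1 : left_id 1 univ_scale.
Proof. by move=> x; apply: ev_inj => B g Kg; rewrite !evE// scale1r. Qed.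

Let univ_scaleDr : right_distributive univ_scale +%R.
Proof. by move=> c x y; apply: ev_inj => B g Kg; rewrite !evE// scalerDr. Qed.

Let univ_scaleDl x : {morph univ_scale^~ x : a b / a + b}.
Proof. by move=> a b; apply: ev_inj => B g Kg; rewrite !evE// scalerDl. Qed.

HB.instance Definition _ := GRing.Zmodule_isLmodule.Build R[i] univ
  univ_scaleA univ_scale1 univ_scaleDr univ_scaleDl.

Lemma ev_linear (B : arensMichaelType R) (g : X -> B) : K g ->
  linear (ev g : univ -> B).
Proof. by move=> Kg c x y; rewrite (ev_add Kg) (ev_scale Kg). Qed.

Lemma evB (B : arensMichaelType R) (g : X -> B) (x y : univ) : K g ->
  ev g (x - y) = ev g x - ev g y.
Proof. by move=> Kg; rewrite (ev_add Kg) (ev_scale Kg) scaleN1r. Qed.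

(** * Topology and completeness of the universal algebra *)

Definition univ_seminorms : set (univ -> R) :=
  [set r | exists (B : arensMichaelType R) (g : X -> B) (Q : set (B -> R))
      (q : B -> R),
    [/\ K g, defined_by_seminorms Q,
        forall p, Q p -> forall x y, p (am_mul x y) <= p x * p y,
        Q q & r = q \o ev g]].

Lemma univ_seminormsP r : univ_seminorms r -> is_seminorm r.
Proof.
move=> [B [g [Q [q [Kg [Qsn _] _ /Qsn[qD qZ] ->]]]]]; split => [x y|c x] /=.
  by rewrite (ev_add Kg); exact: qD.
by rewrite (ev_scale Kg); exact: qZ.
Qed.

Definition univ_am : Type := seminormed univ_seminormsP.
HB.instance Definition _ := Tvs.on univ_am.

(** Each seminorm of [univ_am] factors through a single [ev g], so its balls are controlled by
    convergence in one algebra. *)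
Lemma ev_cvg (F : set_system univ_am) (x : univ_am) : Filter F ->
  (forall (B : arensMichaelType R) (g : X -> B), K g -> ev g @ F --> ev g x) ->
  F --> x.
Proof.
move=> FF Fx; apply: filter_seminorm_nbhs => r e.
move=> [B [g [Q [q [Kg Qdef _ Qq ->]]]]] e0.
have /(lcs_cvgP Qdef)/(_ q e Qq e0) := Fx _ _ Kg.
by apply: (@filterS _ F) => y /=; rewrite evB.
Qed.

Lemma ev_continuous (B : arensMichaelType R) (g : X -> B) : K g ->
  continuous (ev g : univ_am -> B).
Proof.
move=> Kg x; have [Q Qdef Qm] := @am_seminorms R B.
have FF : Filter (nbhs (x : univ_am)).
  by apply: nbhs_filter.
have FG := fmap_filter (ev g) FF.
apply/(lcs_cvgP Qdef) => q e Qq e0.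
exists [set q \o ev g], e; split => //.
  by move=> _ ->; exists B, g, Q, q.
by move=> y /(_ _ erefl) /=; rewrite evB.
Qed.

Let univ_hausdorff : hausdorff_space univ_am.
Proof.
move=> x y xy; apply: ev_inj => B g Kg.
apply: lcs_hausdorff => U V /(ev_continuous Kg) Ux /(ev_continuous Kg) Vy.
by have [z [Uz Vz]] := xy _ _ Ux Vy; exists (ev g z).
Qed.

(* Kowalsky's diagonal filter, formed from filters representing the points of
   the given Cauchy filter, represents a limit. *)
Let univ_complete (F : set_system univ_am) : ProperFilter F ->
  (fun xy : univ_am * univ_am => xy.1 - xy.2) @ filter_prod F F -->
    (0 : univ_am) ->
  exists x : univ_am, F --> x.
Proof.
move=> FF F0.
(* Being linear and continuous, [ev g] sends [F] to a Cauchy filter of [B], which converges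
   there. *)
have Flim (B : arensMichaelType R) (g : X -> B) : K g ->
    exists b : B, ev g @ F --> b.
  move=> Kg; apply: lcs_complete => U.
  have <- : ev g (0 : univ_am) = 0 by exact: ev_zero.
  move=> /(ev_continuous Kg)/F0[[V W] /= [FV FW] VW].
  exists (ev g @` V, ev g @` W).
    by split; [move: FV|move: FW]; apply: (@filterS _ F) => z; exists z.
  move=> [_ _] /= [[x Vx <-] [y Wy <-]]; rewrite -evB//.
  exact: (VW (x, y)).
pose D : set_system (expr R X) := [set U | F [set x | cf_sets (repr x) U]].
have DF : ProperFilter D.
  split.
    move=> D0; have [x] := @filter_ex _ F FF _ D0.
    exact: (@filter_not_empty _ (cf_sets (repr x))).
  split.
  - by apply: (filterS (F := F) _ filterT) => x _; exact: filterT.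
  - move=> U V FU FV; apply: (@filterS _ F) (filterI (FU : F _) (FV : F _)).
    by move=> x [] /=; exact: (@filterI _ (cf_sets (repr x))).
  - move=> U V UV; apply: (@filterS _ F) => x.
    exact: (@filterS _ (cf_sets (repr x))).
have Dlim (B : arensMichaelType R) (g : X -> B) (b : B) : K g ->
    ev g @ F --> b -> eval g @ D --> b.
  (* Passing to an open [V] matters: it is then a neighbourhood of [ev g x] for [F]-most [x], so the
     filter representing such an [x] contains its preimage. *)
  move=> Kg Fb U; rewrite nbhsE => -[V [Vop Vb] VU].
  have FV : F (ev g @^-1` V) by apply: Fb; exact: open_nbhs_nbhs.
  apply: (@filterS _ F) FV => x Vx.
  apply: (@filterS _ (cf_sets (repr x)) _ (eval g @^-1` V)).
    by move=> t; exact: VU.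
  by apply: (cf_limP (F := repr x) Kg); exact: open_nbhs_nbhs.
pose lim (B : arensMichaelType R) (g : X -> B) : B :=
  xget 0 [set b : B | ev g @ F --> b].
have limP (B : arensMichaelType R) (g : X -> B) : K g -> ev g @ F --> lim B g.
  by move=> /Flim; exact: xgetPex.
have [x xlim] := univ_ex (phi := lim) DF
  (fun B g Kg => Dlim B g _ Kg (limP B g Kg)).
by exists x; apply: ev_cvg => B g Kg; rewrite xlim//; exact: limP.
Qed.

HB.instance Definition _ :=
  isCompleteHausdorff.Build R univ_am univ_hausdorff univ_complete.

(** * Arens-Michael structure of the universal algebra *)

Let univ_mulA : associative (univ_mul : univ_am -> univ_am -> univ_am).
Proof. by move=> x y z; apply: ev_inj => B g Kg; rewrite !evE// am_mulA. Qed.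

Let univ_mul1l : left_id (univ_one : univ_am) univ_mul.
Proof. by move=> x; apply: ev_inj => B g Kg; rewrite !evE// am_mul1l. Qed.

Let univ_mul1r : right_id (univ_one : univ_am) univ_mul.
Proof. by move=> x; apply: ev_inj => B g Kg; rewrite !evE// am_mul1r. Qed.

Let univ_linearl (y : univ_am) : linear (univ_mul ^~ y : univ_am -> univ_am).
Proof.
move=> c x z; apply: ev_inj => B g Kg.
rewrite /= (ev_linear Kg) !(ev_mul Kg) (ev_linear Kg).
exact: am_linearl.
Qed.

Let univ_linearr (x : univ_am) : linear (univ_mul x : univ_am -> univ_am).
Proof.
move=> c y z; apply: ev_inj => B g Kg.
rewrite /= (ev_linear Kg) !(ev_mul Kg) (ev_linear Kg).
exact: am_linearr.
Qed.

Let univ_am_seminorms :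
  exists2 P : set (univ_am -> R), defined_by_seminorms P &
  forall p, P p -> forall x y, p (univ_mul x y) <= p x * p y.
Proof.
exists univ_seminorms; first by split => //; exact: univ_seminormsP.
by move=> _ [B [g [Q [q [Kg _ Qm Qq ->]]]]] x y /=; rewrite (ev_mul Kg) Qm.
Qed.

HB.instance Definition _ := isArensMichael.Build R univ_am
  univ_mulA univ_mul1l univ_mul1r univ_linearl univ_linearr univ_am_seminorms.

(** * Generators and homomorphisms out of the universal algebra *)

Definition univ_gen (x : X) : univ_am := univ_of_expr (EGen R x).

Lemma ev_gen (B : arensMichaelType R) (g : X -> B) x : K g ->
  ev g (univ_gen x) = g x.
Proof. by move=> Kg; rewrite ev_expr. Qed.

Lemma ev_alg_hom (B : arensMichaelType R) (g : X -> B) : K g ->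
  alg_hom (ev g : univ_am -> B).
Proof.
move=> Kg; split; [exact: ev_linear|exact: ev_continuous|exact: ev_one|].
by move=> x y; exact: ev_mul.
Qed.

Lemma univ_hom_unique (B : arensMichaelType R) (f f' : univ_am -> B) :
  alg_hom f -> alg_hom f' ->
  (forall x, f (univ_gen x) = f' (univ_gen x)) -> f = f'.
Proof.
move=> fhom f'hom ff'; apply/funext => x.
(* The filter representing [x], evaluated in the universal algebra itself, converges to [x]:
   composing with [ev g] gives back the filter whose limit is [ev g x]. *)
have dense : eval univ_gen @ cf_sets (repr x) --> x.
  apply: ev_cvg => B' g Kg; rewrite -fmap_comp.
  suff -> : ev g \o eval univ_gen = eval g by exact: cf_limP.
  apply/funext => t /=; rewrite (alg_hom_eval _ _ (ev_alg_hom Kg)).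
  by congr eval; apply/funext => z /=; exact: ev_gen.
have [_ fc _ _] := fhom; have [_ f'c _ _] := f'hom.
have fx := cvg_comp _ _ dense (fc x).
have f'x := cvg_comp _ _ dense (f'c x).
apply: lcs_cvg_unique fx _.
suff -> : f \o eval univ_gen = f' \o eval univ_gen by [].
apply/funext => t /=; rewrite !alg_hom_eval//; congr eval.
by apply/funext => z /=.
Qed.

(** The set [X] has no topology; the map [i] stands for the inclusion of one of its summands, which
    has one. *)
Lemma univ_gen_continuous (E : topologicalType) (i : E -> X) :
  (forall (B : arensMichaelType R) (g : X -> B), K g -> continuous (g \o i)) ->
  continuous (univ_gen \o i).
Proof.
move=> gi x; apply: ev_cvg => B g Kg.
have e : ev g \o (univ_gen \o i) = g \o i.
  by apply/funext => y /=; exact: ev_gen.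
by rewrite -fmap_comp e (ev_gen _ Kg); exact: gi.
Qed.

Lemma univ_gen_linear (E : lmodType R[i]) (i : E -> X) :
  (forall (B : arensMichaelType R) (g : X -> B), K g -> linear (g \o i)) ->
  linear (univ_gen \o i : E -> univ_am).
Proof.
move=> gi c x y; apply: ev_inj => B g Kg.
rewrite (ev_linear Kg) !(ev_gen _ Kg); exact: gi.
Qed.

End universal.

(** * Topologically inverse bimodules *)

Theorem theorem2p2 (R : realType) (A : arensMichaelType R)
    (M Minv T1 T2 : bimodType A)
    (tau1 : M -> Minv -> T1) (tau2 : Minv -> M -> T2)
    (i1 : T1 -> A) (i2 : T2 -> A)
    (A_frechet : frechet A) (M_frechet : frechet M) (Minv_frechet : frechet Minv)
    (tau1_tensor : is_tensor tau1) (tau2_tensor : is_tensor tau2)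
    (M_Minv_inverse : topologically_inverse tau1 tau2 i1 i2) :
  exists (L : arensMichaelType R)
    (theta : A -> L) (alpha : M -> L) (beta : Minv -> L),
    topologically_compatible tau1 tau2 i1 i2 theta alpha beta /\
    forall (B : arensMichaelType R)
      (theta' : A -> B) (alpha' : M -> B) (beta' : Minv -> B),
      topologically_compatible tau1 tau2 i1 i2 theta' alpha' beta' ->
      exists! f : L -> B,
        [/\ alg_hom f,
            forall a, f (theta a) = theta' a,
            forall x, f (alpha x) = alpha' x &
            forall y, f (beta y) = beta' y].
Proof.
(* [X] is a bare disjoint union; linearity, continuity and the bimodule laws are imposed only
   through [K]. *)
pose X : Type := (A + M + Minv)%type.
pose iA (a : A) : X := inl (inl a).
pose iM (x : M) : X := inl (inr x).
pose iMinv (y : Minv) : X := inr y.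
pose K (B : arensMichaelType R) (g : X -> B) :=
  topologically_compatible tau1 tau2 i1 i2 (g \o iA) (g \o iM) (g \o iMinv).
(* Multiplicativity restated with [am_mul] of [univ_am K], the form in which products occur in the
   compatibility clauses. *)
have evM (B : arensMichaelType R) (g : X -> B) (x y : univ_am K) : K B g ->
    ev g (am_mul x y) = am_mul (ev g x) (ev g y).
  by move=> Kg; exact: (ev_mul Kg).
exists (univ_am K), (univ_gen K \o iA), (univ_gen K \o iM),
  (univ_gen K \o iMinv); split.
  (* Each clause of compatibility is tested after every [ev g], where it becomes the same clause of
     the assumption [K B g]. *)
  split.
  - split; first by apply: univ_gen_linear => B g [[]].
    + by apply: univ_gen_continuous => B g [[]].
    + apply: ev_inj => B g Kg; rewrite (ev_gen _ Kg).
      by case: (ev_alg_hom Kg) => _ _ -> _; case: Kg => -[].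
    + move=> a b; apply: ev_inj => B g Kg.
      by rewrite evM// !(ev_gen _ Kg); case: Kg => -[_ _ _ h] _ _ _ _; exact: h.
  - split; first by apply: univ_gen_linear => B g [_ []].
    + by apply: univ_gen_continuous => B g [_ []].
    + move=> a x; apply: ev_inj => B g Kg.
      by rewrite evM// !(ev_gen _ Kg); case: Kg => _ [_ _ h _] _ _ _; exact: h.
    + move=> x a; apply: ev_inj => B g Kg.
      by rewrite evM// !(ev_gen _ Kg); case: Kg => _ [_ _ _ h] _ _ _; exact: h.
  - split; first by apply: univ_gen_linear => B g [_ _ []].
    + by apply: univ_gen_continuous => B g [_ _ []].
    + move=> a x; apply: ev_inj => B g Kg.
      by rewrite evM// !(ev_gen _ Kg); case: Kg => _ _ [_ _ h _] _ _; exact: h.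
    + move=> x a; apply: ev_inj => B g Kg.
      by rewrite evM// !(ev_gen _ Kg); case: Kg => _ _ [_ _ _ h] _ _; exact: h.
  - move=> x y; apply: ev_inj => B g Kg.
    by rewrite evM// !(ev_gen _ Kg); case: Kg => _ _ _ h _; exact: h.
  - move=> x y; apply: ev_inj => B g Kg.
    by rewrite evM// !(ev_gen _ Kg); case: Kg => _ _ _ _ h; exact: h.
move=> B theta alpha beta compat.
pose g (z : X) : B :=
  match z with
  | inl (inl a) => theta a
  | inl (inr x) => alpha x
  | inr y => beta y
  end.
(* The components of [g] are convertible to [theta], [alpha] and [beta], so this is [compat]. *)
have Kg : K B g by [].
exists (ev g : univ_am K -> B); split.
  split; first exact: ev_alg_hom.
  - by move=> a; exact: (ev_gen (iA a) Kg).
  - by move=> x; exact: (ev_gen (iM x) Kg).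
  - by move=> y; exact: (ev_gen (iMinv y) Kg).
move=> f [fhom fA fM fMinv]; apply: (univ_hom_unique (ev_alg_hom Kg) fhom).
by move=> [[a|x]|y]; rewrite (ev_gen _ Kg) /=; symmetry;
  [exact: fA|exact: fM|exact: fMinv].
Qed.
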